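(* Let $T\ge 1$ be an integer, $0<c_1\le c_2$ real numbers, $\{R_k\}_{k\in N_T}$ a sequence of real symmetric positive definite $n\times n$ matrices, and for $k\in N_{T-1}$ let $A_k,C_k\in\mathbb{R}^{n\times n}$ and $B_k,D_k\in\mathbb{R}^{n\times m}$. Suppose there exist symmetric matrices $X_i\in\mathbb{R}^{n\times n}$ ($i\in N_T$), matrices $Y_j\in\mathbb{R}^{m\times n}$ ($j\in N_{T-1}$), and scalars $\hat\lambda_1>0$, $\hat\lambda_2>0$ with $\hat\lambda_1\ge\hat\lambda_2$, such that for all $i\in N_T$ and $j\in N_{T-1}$ $$\hat\lambda_2R_i^{-1}\le X_i\le\hat\lambda_1R_i^{-1},$$ $$c_1\hat\lambda_1-c_2\hat\lambda_2<0,$$ $$\begin{bmatrix}-X_j&(A_jX_j+B_jY_j)'&(C_jX_j+D_jY_j)'\\ *&-X_{j+1}&0\\ *&*&-X_{j+1}\end{bmatrix}<0.$$ Then the control system $x_{k+1}=A_kx_k+B_ku_k+(C_kx_k+D_ku_k)w_k$, $x_0\in\mathbb{R}^n$, $k\in N_{T-1}$, is finite-time stabilizable with respect to $(c_1,c_2,T,\{R_k\}_{k\in N_T})$ via a linear state feedback $u_k=K_kx_k$, and the desired controller gains are given by $K_j=Y_jX_j^{-1}$, $j\in N_{T-1}$.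
   Context: $N_T:=\{0,1,\dots,T\}$. $M'$ is the transpose; for symmetric matrices $M<0$ means negative definite and $M\le N$ means $N-M$ is positive semidefinite; $*$ denotes blocks determined by symmetry. $\|x\|_R^2:=x'Rx$. $\{w_k\}_{k\in N_{T-1}}$ is a sequence of independent real random variables on a complete probability space with $E[w_k]=0$ and $E[w_kw_j]=\delta_{kj}$ (Kronecker delta); $x_0$ is deterministic; $u_k\in\mathbb{R}^m$ is the control input. Finite-time stability: a system $x_{k+1}=F_kx_k+G_kx_kw_k$, $k\in N_{T-1}$, is finite-time stable with respect to $(c_1,c_2,T,\{R_k\}_{k\in N_T})$ if for every deterministic $x_0\in\mathbb{R}^n$, $\|x_0\|_{R_0}^2\le c_1$ implies $E\|x_k\|_{R_k}^2<c_2$ for all $k\in N_T$. Finite-time stabilizability: the control system is finite-time stabilizable with respect to $(c_1,c_2,T,\{R_k\}_{k\in N_T})$ if there is a linear state feedback $u_k=K_kx_k$, $k\in N_{T-1}$, such that the closed-loop system $x_{k+1}=(A_k+B_kK_k)x_k+(C_k+D_kK_k)x_kw_k$ is finite-time stable with respect to $(c_1,c_2,T,\{R_k\}_{k\in N_T})$. *)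

(* Defs.v *)
From HB Require Import structures.
From mathcomp Require Import all_boot all_order all_algebra.
From mathcomp Require Import all_classical all_reals all_analysis.

Set Implicit Arguments.
Unset Strict Implicit.
Unset Printing Implicit Defensive.

Import Order.TTheory GRing.Theory Num.Theory.

Local Open Scope classical_set_scope.
Local Open Scope ring_scope.

(* Families indexed by {0, ..., T} or {0, ..., T-1} are functions on nat; only
   their values at k <= T, resp. k < T, are ever constrained or used. *)

(* x' M x *)
Definition qform (R : realType) (n : nat) (M : 'M[R]_n) (x : 'cV[R]_n) : R :=
  (x^T *m M *m x) 0 0.

Definition posdefmx (R : realType) (n : nat) (M : 'M[R]_n) : Prop :=
  M \is symmetricmx /\ forall x : 'cV[R]_n, x != 0 -> 0 < qform M x.

Definition possemidefmx (R : realType) (n : nat) (M : 'M[R]_n) : Prop :=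
  M \is symmetricmx /\ forall x : 'cV[R]_n, 0 <= qform M x.

Definition negdefmx (R : realType) (n : nat) (M : 'M[R]_n) : Prop :=
  M \is symmetricmx /\ forall x : 'cV[R]_n, x != 0 -> qform M x < 0.

Definition loewner_le (R : realType) (n : nat) (M N : 'M[R]_n) : Prop :=
  possemidefmx (N - M).

(* Mutual independence of w_0, ..., w_{T-1}: the product rule for every
   subfamily J and all Borel sets B_k. *)
Definition independent_RVs (d : measure_display) (Omega : measurableType d)
    (R : realType) (P : probability Omega R) (T : nat)
    (w : nat -> {RV P >-> R}) : Prop :=
  forall (J : {set 'I_T}) (B : 'I_T -> set R),
    (forall k, measurable (B k)) ->
    (P (\bigcap_(k in [set k | k \in J]) (w k @^-1` B k)) =
      \prod_(k in J) P (w k @^-1` B k))%E.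

(* The solution of x_{k+1} = F_k x_k + G_k x_k w_k started at x0. *)
Fixpoint trajectory (Omega : Type) (R : realType) (n : nat)
    (F G : nat -> 'M[R]_n) (w : nat -> Omega -> R) (x0 : 'cV[R]_n)
    (k : nat) (omega : Omega) : 'cV[R]_n :=
  if k is k'.+1 then
    F k' *m trajectory F G w x0 k' omega
    + w k' omega *: (G k' *m trajectory F G w x0 k' omega)
  else x0.

Definition finite_time_stable (d : measure_display) (Omega : measurableType d)
    (R : realType) (P : probability Omega R) (w : nat -> {RV P >-> R})
    (n : nat) (F G : nat -> 'M[R]_n)
    (c1 c2 : R) (T : nat) (W : nat -> 'M[R]_n) : Prop :=
  forall x0 : 'cV[R]_n, qform (W 0) x0 <= c1 ->
  forall k : nat, (k <= T)%N ->
    ('E_P[fun omega => qform (W k) (trajectory F G w x0 k omega)] < c2%:E)%E.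

(* Finite-time stability of x_{k+1} = A_k x_k + B_k u_k + (C_k x_k + D_k u_k) w_k
   under the state feedback u_k = K_k x_k. *)
Definition closed_loop_stable (d : measure_display) (Omega : measurableType d)
    (R : realType) (P : probability Omega R) (w : nat -> {RV P >-> R})
    (n m : nat) (A C : nat -> 'M[R]_n) (B D : nat -> 'M[R]_(n, m))
    (K : nat -> 'M[R]_(m, n))
    (c1 c2 : R) (T : nat) (W : nat -> 'M[R]_n) : Prop :=
  finite_time_stable w (fun k => A k + B k *m K k) (fun k => C k + D k *m K k)
    c1 c2 T W.

Definition finite_time_stabilizable (d : measure_display)
    (Omega : measurableType d) (R : realType) (P : probability Omega R)
    (w : nat -> {RV P >-> R})
    (n m : nat) (A C : nat -> 'M[R]_n) (B D : nat -> 'M[R]_(n, m))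
    (c1 c2 : R) (T : nat) (W : nat -> 'M[R]_n) : Prop :=
  exists K : nat -> 'M[R]_(m, n), closed_loop_stable w A C B D K c1 c2 T W.

(* [ -X   E'   G'  ]
   [  E  -X1   0   ]
   [  G   0   -X1  ] *)
Definition lmi_block (R : realType) (n : nat) (X X1 E G : 'M[R]_n) :
    'M[R]_(n + (n + n)) :=
  block_mx (- X) (row_mx E^T G^T)
           (col_mx E G) (block_mx (- X1) 0 0 (- X1)).

(* Main.v *)
Require Import Defs.
From HB Require Import structures.
From mathcomp Require Import all_boot all_order all_algebra.
From mathcomp Require Import all_classical all_reals all_analysis.
From mathcomp Require Import measurable_realfun ring lra.

Set Implicit Arguments.
Unset Strict Implicit.
Unset Printing Implicit Defensive.

Import Order.TTheory GRing.Theory Num.Theory.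

Local Open Scope classical_set_scope.
Local Open Scope ring_scope.

(** The proof is a mean-square Lyapunov argument. Write [Q k] for the inverse of
    [X k] and [x_k] for the closed-loop state, so that
    [x_(k+1) = F x_k + w_k G x_k] with [F = A_k + B_k K_k] and
    [G = C_k + D_k K_k].

    The bounds [l2 W_k^-1 <= X_k <= l1 W_k^-1] force [X_k] to be positive
    definite and invert to [W_k <= l1 Q_k] and [l2 Q_k <= W_k]
    ([invmx_sandwich]). The block inequality, evaluated at the vector that
    eliminates its lower right block, says that
    [F' Q_(k+1) F + G' Q_(k+1) G <= Q_k] ([lmi_block_decrease]): the
    substitution [K = Y X^-1] turns [(A X + B Y) X^-1] into [A + B K].

    On the probabilistic side, [x_k] is a function of [w_0, ..., w_(k-1)] and
    therefore independent of [w_k]. By Tonelli the noise [w_k] can be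
    integrated with [x_k] held fixed, and since it has mean zero and variance
    one this gives
    [E (x_(k+1)' M x_(k+1)) = E (x_k' (F' M F + G' M G) x_k)]
    ([expectation_qform_step]). With [M = Q_(k+1)] the expectation of
    [x_k' Q_k x_k] is nonincreasing in [k], whence
    [E (x_k' W_k x_k) <= l1 E (x_k' Q_k x_k) <= l1 (x_0' Q_0 x_0)
     <= (l1 / l2) (x_0' W_0 x_0) <= c1 l1 / l2 < c2]. *)

(** * Quadratic forms and the matrix inequality *)

Section Quadratic_forms.
Variables (R : realType) (n : nat).
Implicit Types (M N : 'M[R]_n) (x y : 'cV[R]_n).

Lemma symmetricmxP M : M \is symmetricmx <-> M^T = M.
Proof.
rewrite is_hermitianmxE expr0 scale1r map_mx_id //.
by split=> [/eqP <-|->].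
Qed.

(** [mxE] would also unfold the products inside [A] and [B]; these rules
    leave them folded. *)
Let entD (A B : 'M[R]_1) : (A + B) 0 0 = A 0 0 + B 0 0.
Proof. by rewrite mxE. Qed.

Let entN (A : 'M[R]_1) : (- A) 0 0 = - A 0 0.
Proof. by rewrite mxE. Qed.

Let entZ a (A : 'M[R]_1) : (a *: A) 0 0 = a * A 0 0.
Proof. by rewrite mxE. Qed.

Lemma qform_congr p M (E : 'M[R]_(n, p)) (x : 'cV[R]_p) :
  qform M (E *m x) = qform (E^T *m M *m E) x.
Proof. by rewrite /qform trmx_mul !mulmxA. Qed.

Lemma qformZmx a M x : qform (a *: M) x = a * qform M x.
Proof. by rewrite /qform -scalemxAr -scalemxAl entZ. Qed.

Lemma qformBmx M N x : qform (N - M) x = qform N x - qform M x.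
Proof. by rewrite /qform mulmxBr mulmxBl entD entN. Qed.

Lemma qform0 M : qform M 0 = 0.
Proof. by rewrite /qform mulmx0 mxE. Qed.

Lemma qformDZ M x y a : M \is symmetricmx ->
  qform M (x + a *: y) =
  qform M x + a * (2 * (x^T *m M *m y) 0 0) + a ^+ 2 * qform M y.
Proof.
move=> /symmetricmxP Msym.
have yMx : (y^T *m M *m x) 0 0 = (x^T *m M *m y) 0 0.
  by rewrite -[in LHS](trmxK (y^T *m M *m x)) mxE !trmx_mul trmxK Msym mulmxA.
rewrite /qform.
have -> : (x + a *: y)^T = x^T + a *: y^T by rewrite linearD linearZ.
rewrite !mulmxDl !mulmxDr -!scalemxAl -!scalemxAr.
rewrite !entD !entZ yMx; ring.
Qed.

Lemma loewner_leP M N : loewner_le M N -> forall x, qform M x <= qform N x.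
Proof. by move=> [_ MN] x; have := MN x; rewrite qformBmx subr_ge0. Qed.

Lemma posdefmx_ge0 M : posdefmx M -> forall x, 0 <= qform M x.
Proof.
move=> [_ M0] x; have [->|x0] := eqVneq x 0; first by rewrite qform0.
exact/ltW/M0.
Qed.

Lemma posdefmx_unit M : posdefmx M -> M \in unitmx.
Proof.
move=> [_ M0]; rewrite unitmxE unitfE; apply/negP => /det0P[v v0 vM].
have /M0 : v^T != 0 by rewrite -(inj_eq trmx_inj) trmxK trmx0.
by rewrite /qform trmxK vM mul0mx mxE ltxx.
Qed.

Lemma posdefmx_le M N : posdefmx M -> N \is symmetricmx ->
  (forall x, qform M x <= qform N x) -> posdefmx N.
Proof. by move=> [_ M0] Nsym MN; split=> // x /M0/lt_le_trans; apply. Qed.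

Lemma posdefmxZ a M : 0 < a -> posdefmx M -> posdefmx (a *: M).
Proof.
move=> a0 [/symmetricmxP Msym M0]; split.
  by apply/symmetricmxP; rewrite linearZ /= Msym.
by move=> x /M0 Mx; rewrite qformZmx mulr_gt0.
Qed.

Lemma qform_invmx M x : posdefmx M ->
  qform (invmx M) x = qform M (invmx M *m x).
Proof.
move=> Mpos; have Mu := posdefmx_unit Mpos.
have [/symmetricmxP Msym _] := Mpos.
by rewrite qform_congr trmx_inv Msym mulVmx // mul1mx.
Qed.

Lemma posdefmx_inv M : posdefmx M -> posdefmx (invmx M).
Proof.
move=> Mpos; have Mu := posdefmx_unit Mpos.
have [/symmetricmxP Msym M0] := Mpos; split.
  by apply/symmetricmxP; rewrite trmx_inv Msym.
move=> x x0; rewrite qform_invmx //; apply: M0.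
by apply: contra_neq x0 => Mx0; rewrite -(mulKVmx Mu x) Mx0 mulmx0.
Qed.

(** The right-hand side minus the left-hand side is the square
    [qform M (invmx M *m x - y)]; equality holds at [y = invmx M *m x], so the
    inverse form is the Legendre transform of the form. *)
Lemma qform_invmx_ge M x y : posdefmx M ->
  2 * (x^T *m y) 0 0 - qform M y <= qform (invmx M) x.
Proof.
move=> Mpos; have Mu := posdefmx_unit Mpos.
have [Msym _] := Mpos; have /symmetricmxP MsymT := Msym.
have := posdefmx_ge0 Mpos (invmx M *m x + (-1) *: y).
rewrite qformDZ // -qform_invmx // trmx_mul trmx_inv MsymT mulmxKV //; lra.
Qed.

Lemma qform_invmx_eq M x : posdefmx M ->
  qform (invmx M) x =
  2 * (x^T *m (invmx M *m x)) 0 0 - qform M (invmx M *m x).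
Proof. move=> Mpos; rewrite -qform_invmx // /qform mulmxA; ring. Qed.

(** Inversion reverses the Loewner order, because it does so for a maximum
    over [y] of expressions in which the form occurs with a minus sign. *)
Lemma qform_invmx_anti M N x : posdefmx M -> posdefmx N ->
  (forall y, qform M y <= qform N y) ->
  qform (invmx N) x <= qform (invmx M) x.
Proof.
move=> Mpos Npos MN; rewrite (qform_invmx_eq _ Npos).
apply: le_trans (qform_invmx_ge x (invmx N *m x) Mpos).
by rewrite lerD2l lerN2 MN.
Qed.

Lemma invmx_scale a M : 0 < a -> posdefmx M ->
  invmx (a *: M) = a^-1 *: invmx M.
Proof.
move=> a0 Mpos; have Mu := posdefmx_unit Mpos.
by rewrite invmxZ // unitmxZ // unitfE gt_eqF.
Qed.

(** [l2 W^-1] is positive definite, hence so is [X] above it; the two bounds on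
    the inverse of [X] are then [qform_invmx_anti] applied to each side. *)
Lemma invmx_sandwich (W X : 'M[R]_n) l1 l2 : 0 < l1 -> 0 < l2 ->
  posdefmx W -> X \is symmetricmx ->
  loewner_le (l2 *: invmx W) X -> loewner_le X (l1 *: invmx W) ->
  [/\ posdefmx X,
      forall x, qform W x <= l1 * qform (invmx X) x &
      forall x, l2 * qform (invmx X) x <= qform W x].
Proof.
move=> l10 l20 Wpos Xsym /loewner_leP WX /loewner_leP XW.
have Wipos := posdefmx_inv Wpos.
have pos1 := posdefmxZ l10 Wipos; have pos2 := posdefmxZ l20 Wipos.
have Xpos := posdefmx_le pos2 Xsym WX; split=> // x.
- have := qform_invmx_anti x Xpos pos1 XW.
  by rewrite invmx_scale // invmxK qformZmx mulrC ler_pdivrMr // mulrC.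
- have := qform_invmx_anti x pos2 Xpos WX.
  by rewrite invmx_scale // invmxK qformZmx mulrC ler_pdivlMr // mulrC.
Qed.

Lemma qform_lmi_block (X X1 E G : 'M[R]_n) (z u v : 'cV[R]_n) :
  qform (lmi_block X X1 E G) (col_mx z (col_mx u v)) =
  - qform X z + 2 * ((u^T *m (E *m z)) 0 0 + (v^T *m (G *m z)) 0 0)
  - qform X1 u - qform X1 v.
Proof.
have tr (A : 'M[R]_n) (s t : 'cV[R]_n) :
    (s^T *m A^T *m t) 0 0 = (t^T *m (A *m s)) 0 0.
  by rewrite -[in LHS](trmxK (s^T *m A^T *m t)) mxE !trmx_mul !trmxK.
rewrite /qform /lmi_block -mulmxA mul_block_col mul_row_col mul_block_col.
rewrite mul_col_mx add_col_mx !tr_col_mx !mul_row_col !mul0mx addr0 add0r.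
rewrite !mulmxDr !mulNmx !mulmxN !mulmxA.
rewrite !entD !tr !entN !mulmxA; ring.
Qed.

(** This is the Schur complement of the block inequality with respect to its
    lower right block: with first component [z = X^-1 x], the form is largest
    at [(z, X1^-1 E z, X1^-1 G z)], and that is where it is evaluated. *)
Lemma lmi_block_decrease (X X1 E G : 'M[R]_n) (x : 'cV[R]_n) :
  posdefmx X -> posdefmx X1 -> negdefmx (lmi_block X X1 E G) ->
  qform (invmx X1) (E *m invmx X *m x) + qform (invmx X1) (G *m invmx X *m x)
    <= qform (invmx X) x.
Proof.
move=> Xpos X1pos [_ neg].
set z := invmx X *m x.
set u := invmx X1 *m (E *m z); set v := invmx X1 *m (G *m z).
have : qform (lmi_block X X1 E G) (col_mx z (col_mx u v)) <= 0.
  have [->|w0] := eqVneq (col_mx z (col_mx u v)) 0; last exact/ltW/neg.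
  by rewrite /qform mulmx0 mxE.
have [/symmetricmxP invsym _] := posdefmx_inv X1pos.
have dot y : ((invmx X1 *m y)^T *m y) 0 0 = qform (invmx X1) y.
  by rewrite trmx_mul invsym.
rewrite qform_lmi_block !dot -!qform_invmx // -!mulmxA; lra.
Qed.

End Quadratic_forms.

(** * Independence of the past and the present noise *)

Section Independence.
Context d (Omega : measurableType d) (R : realType) (P : probability Omega R).

(** Independence makes the joint law the product of the two laws; for that
    product the formula is Tonelli's theorem. *)
Lemma ge0_integral_indep d1 d2 (T1 : measurableType d1)
    (T2 : measurableType d2) (U : {mfun Omega >-> T1})
    (V : {mfun Omega >-> T2}) (h : T1 * T2 -> \bar R) :
  (forall A B, measurable A -> measurable B ->
    P (U @^-1` A `&` V @^-1` B) = (P (U @^-1` A) * P (V @^-1` B))%E) ->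
  measurable_fun setT h -> (forall z, 0 <= h z)%E ->
  (\int[P]_o h (U o, V o) = \int[P]_o \int[P]_o' h (U o, V o'))%E.
Proof.
move=> UV mh h0.
pose UxV o := (U o, V o).
have mUxV : measurable_fun setT UxV by exact/measurable_fun_pairP.
pose pUV : {mfun Omega >-> (T1 * T2)%type} :=
  HB.pack UxV (isMeasurableFun.Build _ _ _ _ UxV mUxV).
transitivity (\int[distribution P pUV]_z h z)%E.
  by rewrite ge0_integral_distribution.
transitivity (\int[(distribution P U \x distribution P V)%E]_z h z)%E.
  apply: eq_measure_integral => A mA _; apply/esym.
  by apply: (@product_measure_unique _ _ _ _ _ _ _ (distribution P pUV)).
rewrite fubini_tonelli1 // ge0_integral_distribution //; last 2 first.
- exact: measurable_fun_fubini_tonelli_F.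
- by move=> x; apply: integral_ge0.
apply: eq_integral => o _ /=.
rewrite /fubini_F ge0_integral_distribution //.
exact: measurable_fun_pair2.
Qed.

Variable w : nat -> {RV P >-> R}.

(** The cylinder events of [w_0, ..., w_(k-1)]. Only the factors [B i] with
    [i < k] enter; indexing [B] by all of ['I_T] matches the index type of
    [independent_RVs]. *)
Definition past_rectangles T k : set (set Omega) :=
  [set A | exists2 B : 'I_T -> set R, forall i, measurable (B i) &
    A = \bigcap_(i in [set i : 'I_T | (i < k)%N]) (w i @^-1` B i)].

Lemma past_rectangles_measurable T k :
  past_rectangles T k `<=` measurable.
Proof.
move=> _ [B mB ->]; apply: fin_bigcap_measurable.
  exact: finite_finset.
move=> i _; rewrite -[X in measurable X]setTI; exact: measurable_funP.
Qed.

Lemma past_rectangles_setI T k : setI_closed (past_rectangles T k).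
Proof.
move=> _ _ [B mB ->] [B' mB' ->].
exists (fun i => B i `&` B' i); first by move=> i; exact: measurableI.
by rewrite -bigcapI.
Qed.

Lemma past_rectangles_setT T k : past_rectangles T k setT.
Proof.
by exists (fun=> setT) => //; apply/seteqP; split=> // o _ i _.
Qed.

(** Both sides are finite measures in [A]; by hypothesis they agree on the
    rectangles, which are stable under intersection. *)
Lemma indep_past T k (A : set Omega) (B : set R) :
  independent_RVs T w -> (k < T)%N -> <<s past_rectangles T k >> A ->
  measurable B -> P (A `&` w k @^-1` B) = (P A * P (w k @^-1` B))%E.
Proof.
move=> indep kT; set pB := P (w k @^-1` B) => pastA mB.
have mwB : measurable (w k @^-1` B).
  by rewrite -[X in measurable X]setTI; exact: measurable_funP.
have pBfin : pB \is a fin_num by exact: fin_num_measure.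
have pB0 : 0 <= fine pB by apply: fine_ge0; exact: measure_ge0.
pose m1 := mrestr P mwB.
pose m2 := mscale (NngNum pB0) P.
rewrite -[LHS]/(m1 A) muleC -(fineK pBfin) -[RHS]/(m2 A).
apply: (@g_sigma_algebra_measure_unique _ _ _ (past_rectangles T k) _
  (fun=> setT)) => //.
- exact: past_rectangles_measurable.
- by move=> _; exact: past_rectangles_setT.
- by apply/seteqP; split=> // o _; exists 0%N.
- exact: past_rectangles_setI.
- move=> _ [B' mB' ->].
  (* The rectangle and the event of [w k] together form one rectangle over
     [k' |: J], whose [k']-th factor is [B]. *)
  pose k' := Ordinal kT; pose J := [set i : 'I_T | (i < k)%N]%SET.
  have k'J : k' \notin J by rewrite inE ltnn.
  pose B'' i := if i == k' then B else B' i.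
  have mB'' i : measurable (B'' i) by rewrite /B''; case: ifP.
  have B''J i : i \in J -> B'' i = B' i.
    by move=> iJ; rewrite /B'' ifN //; apply: contraNneq k'J => <-.
  rewrite -[LHS]/(P (_ `&` _)) -[RHS]/((fine pB)%:E * P _)%E (fineK pBfin).
  have rectE : \bigcap_(i in [set i : 'I_T | (i < k)%N]) (w i @^-1` B' i) =
      \bigcap_(i in [set i | i \in J]) (w i @^-1` B'' i).
    apply: eq_bigcap => [|i ik]; last by rewrite B''J // inE.
    by split=> i /=; rewrite inE.
  rewrite rectE (indep J _ mB'').
  transitivity (\prod_(i in k' |: J) P (w i @^-1` B'' i))%E.
    rewrite -indep //; congr (P _); apply/seteqP; split=> o.
      move=> [oJ ok] i /=; rewrite !inE => /orP[/eqP ->|ik].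
        by rewrite /B'' eqxx.
      by apply: oJ => /=; rewrite inE.
    move=> ok; split=> [i /= iJ|]; first by apply: ok; rewrite /= inE iJ orbT.
    by have := ok k'; rewrite /= setU11 /B'' eqxx; exact.
  by rewrite big_setU1 //= {1}/B'' eqxx.
- move=> _; rewrite -[X in (X < _)%E]/(P (setT `&` _)) setTI.
  exact: le_lt_trans (probability_le1 P mwB) (ltry 1).
Qed.

End Independence.
(** * The closed-loop recursion in mean square *)

Section Closed_loop.
Context d (Omega : measurableType d) (R : realType) (P : probability Omega R).
Variables (w : nat -> {RV P >-> R}) (T n : nat).
Hypothesis indep : independent_RVs T w.
Hypothesis mean0 : forall k, (k < T)%N -> ('E_P[w k] = 0)%E.
Hypothesis var1 : forall k, (k < T)%N ->
  ('E_P[fun o => (w k o * w k o)%R] = 1)%E.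
Variables (F G : nat -> 'M[R]_n) (x0 : 'cV[R]_n).

(** The sample space with the sigma-algebra generated by the noises before time
    [k]; the same carrier is used so that the state itself is a function on
    it. *)
Let past k := g_sigma_algebraType (past_rectangles w T k).
Let x_ := trajectory F G w x0.

Lemma measurable_qform d' (S : measurableType d') (M : 'M[R]_n)
    (f : S -> 'cV[R]_n) :
  (forall i, measurable_fun setT (fun s => f s i 0)) ->
  measurable_fun setT (fun s => qform M (f s)).
Proof.
move=> mf.
have -> : (fun s => qform M (f s)) =
    (fun s => \sum_j (\sum_i f s i 0 * M i j) * f s j 0).
  apply/funext => s; rewrite /qform mxE; apply: eq_bigr => j _.
  by rewrite mxE; congr (_ * _); apply: eq_bigr => i _; rewrite mxE.
apply: measurable_sum => j; apply: measurable_funM => //.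
by apply: measurable_sum => i; exact: measurable_funM.
Qed.

Lemma measurable_mulmx d' (S : measurableType d') (M : 'M[R]_n)
    (f : S -> 'cV[R]_n) i :
  (forall i, measurable_fun setT (fun s => f s i 0)) ->
  measurable_fun setT (fun s => (M *m f s) i 0).
Proof.
move=> mf; under eq_fun do rewrite mxE.
by apply: measurable_sum => j; exact: measurable_funM.
Qed.

Lemma measurable_step d' (S : measurableType d') (E H : 'M[R]_n)
    (f : S -> 'cV[R]_n) (v : S -> R) i :
  (forall i, measurable_fun setT (fun s => f s i 0)) ->
  measurable_fun setT v ->
  measurable_fun setT (fun s => (E *m f s + v s *: (H *m f s)) i 0).
Proof.
move=> mf mv.
have -> : (fun s => (E *m f s + v s *: (H *m f s)) i 0) =
    (fun s => (E *m f s) i 0 + v s * (H *m f s) i 0).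
  by apply/funext => s; rewrite mxE [X in _ + X]mxE.
apply: measurable_funD; first exact: measurable_mulmx.
by apply: measurable_funM => //; exact: measurable_mulmx.
Qed.

(** The preimage under [w i] is the rectangle with a single nontrivial
    factor. *)
Lemma measurable_noise_past k i : (k <= T)%N -> (i < k)%N ->
  measurable_fun setT (w i : past k -> R).
Proof.
move=> kT ik _ B mB; rewrite setTI; apply: sub_sigma_algebra.
pose i' := Ordinal (leq_trans ik kT).
exists (fun j => if j == i' then B else setT); first by move=> j; case: (j == i').
apply/seteqP; split=> o.
  by move=> wB j /= _; case: eqP => // ->.
by move=> /(_ i' ik) /=; rewrite eqxx.
Qed.

Lemma measurable_trajectory_past k j i : (k <= T)%N -> (j <= k)%N ->
  measurable_fun setT (fun o : past k => x_ j o i 0).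
Proof.
move=> kT; elim: j i => [|j IH] i jk; first exact: measurable_cst.
apply: measurable_step; first by move=> i'; apply: IH; exact: ltnW.
exact: measurable_noise_past.
Qed.

Lemma measurable_to_past k : measurable_fun setT (id : Omega -> past k).
Proof.
have sub : <<s past_rectangles w T k >> `<=` (measurable : set (set Omega)).
  apply: smallest_sub; first exact: sigma_algebra_measurable.
  exact: past_rectangles_measurable.
by move=> _ B mB; rewrite setTI; exact: sub.
Qed.

Lemma measurable_trajectory j i : (j <= T)%N ->
  measurable_fun setT (fun o => x_ j o i 0).
Proof.
move=> jT; have mj := measurable_trajectory_past i jT (leqnn j).
exact: (measurableT_comp mj (@measurable_to_past j)).
Qed.

(** The cross term is linear in the noise and has mean zero. *)
Lemma integral_qform_noise k (M : 'M[R]_n) y z : (k < T)%N ->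
  M \is symmetricmx ->
  (\int[P]_o (qform M (y + w k o *: z))%:E = (qform M y + qform M z)%:E)%E.
Proof.
move=> kT Msym.
have mean : (\int[P]_o (w k o)%:E = 0)%E.
  by rewrite -(mean0 kT) unlock.
have var : (\int[P]_o (w k o * w k o)%:E = 1)%E.
  by rewrite -(var1 kT) unlock.
have mw : measurable_fun setT (w k) by exact: measurable_funP.
have mww : measurable_fun setT (fun o => w k o * w k o).
  exact: measurable_funM.
have iw : P.-integrable setT (EFin \o w k).
  apply/integrableP; split; first exact/measurable_EFinP.
  by rewrite integral_fin_num_abs // mean.
have iww : P.-integrable setT (EFin \o (fun o => w k o * w k o)).
  apply/integrableP; split; first exact/measurable_EFinP.
  by rewrite integral_fin_num_abs // var.
set b := (y^T *m M *m z) 0 0.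
transitivity (\int[P]_o ((qform M y)%:E +
    (((2 * b)%:E * (w k o)%:E) + ((qform M z)%:E * (w k o * w k o)%:E))))%E.
  apply: eq_integral => o _; rewrite qformDZ // -!EFinM -!EFinD /b; congr EFin.
  ring.
have i1 : P.-integrable setT (fun o => ((2 * b)%:E * (w k o)%:E)%E).
  exact: integrableZl.
have i2 : P.-integrable setT
    (fun o => ((qform M z)%:E * (w k o * w k o)%:E)%E).
  exact: integrableZl.
rewrite integralD //; last 2 first.
- exact: finite_measure_integrable_cst.
- exact: integrableD.
rewrite integralD // !integralZl // mean var mule0 mule1 add0e.
by rewrite integral_cst //= probability_setT mule1 -EFinD.
Qed.

(** The state is a function of the earlier noises, hence independent of the
    current one: the noise can be integrated out first, with the state held
    fixed. Positive definiteness of [M] makes the integrand nonnegative, so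
    that Tonelli's theorem applies even before the second moments of the state
    are known to be finite. *)
Lemma expectation_qform_step k (M : 'M[R]_n) : (k < T)%N -> posdefmx M ->
  ('E_P[fun o => qform M (x_ k.+1 o)] =
   'E_P[fun o => (qform M (F k *m x_ k o) + qform M (G k *m x_ k o))%R])%E.
Proof.
move=> kT Mpos; have [Msym _] := Mpos; rewrite unlock.
pose h (z : past k * R) : \bar R :=
  (qform M (F k *m x_ k z.1 + z.2 *: (G k *m x_ k z.1)))%:E.
(* The past is represented by the identity map into the coarser
   sigma-algebra. *)
pose U : {mfun Omega >-> past k} :=
  HB.pack (id : Omega -> past k)
    (isMeasurableFun.Build _ _ _ _ _ (@measurable_to_past k)).
have mh : measurable_fun setT h.
  apply/measurable_EFinP/measurable_qform => i.
  apply: measurable_step => // i'.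
  have mk := measurable_trajectory_past i' (ltnW kT) (leqnn k).
  exact: (measurableT_comp mk measurable_fst).
transitivity (\int[P]_o h (U o, w k o))%E; first by [].
rewrite ge0_integral_indep //; last 2 first.
- by move=> A B mA mB; have := indep_past indep kT mA mB; exact.
- by move=> z; rewrite lee_fin; exact: posdefmx_ge0.
apply: eq_integral => o _; rewrite /h /=.
by rewrite integral_qform_noise.
Qed.

(** By [expectation_qform_step] the pointwise inequality between the forms
    becomes one between consecutive expectations: [Q] is a Lyapunov function
    in mean square. *)
Lemma expectation_qform_decrease (Q : nat -> 'M[R]_n) :
  (forall k, (k <= T)%N -> posdefmx (Q k)) ->
  (forall k y, (k < T)%N ->
    qform (Q k.+1) (F k *m y) + qform (Q k.+1) (G k *m y) <= qform (Q k) y) ->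
  forall k, (k <= T)%N ->
  ('E_P[fun o => qform (Q k) (x_ k o)] <= (qform (Q 0) x0)%:E)%E.
Proof.
move=> Qpos Qdec; elim=> [|k IH] kT; first by rewrite -(expectation_cst P).
rewrite expectation_qform_step //; last exact: Qpos.
apply: le_trans (IH (ltnW kT)).
have mx i : measurable_fun setT (fun o => x_ k o i 0).
  apply: measurable_trajectory; exact: ltnW.
apply: expectation_le.
- by apply: measurable_funD; apply: measurable_qform => i;
    exact: measurable_mulmx.
- exact: measurable_qform.
- by move=> o; rewrite addr_ge0 //; apply: posdefmx_ge0; exact: Qpos.
- by move=> o; apply: posdefmx_ge0; exact/Qpos/ltnW.
- by apply: aeW => o; exact: Qdec.
Qed.

(** [Q] controls [W] up to [l1] at every time and is controlled by it up to
    [l2] at time 0, so the Lyapunov bound transfers to [W] with the loss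
    [l1 / l2]. *)
Lemma expectation_qform_lt (Q W : nat -> 'M[R]_n) c1 c2 l1 l2 :
  0 < l1 -> 0 < l2 -> c1 * l1 < c2 * l2 ->
  (forall k, (k <= T)%N -> posdefmx (Q k)) ->
  (forall k y, (k < T)%N ->
    qform (Q k.+1) (F k *m y) + qform (Q k.+1) (G k *m y) <= qform (Q k) y) ->
  (forall k, (k <= T)%N -> posdefmx (W k)) ->
  (forall k y, (k <= T)%N -> qform (W k) y <= l1 * qform (Q k) y) ->
  l2 * qform (Q 0) x0 <= qform (W 0) x0 ->
  qform (W 0) x0 <= c1 ->
  forall k, (k <= T)%N -> ('E_P[fun o => qform (W k) (x_ k o)] < c2%:E)%E.
Proof.
move=> l10 l20 c12 Qpos Qdec Wpos WQ QW0 Wc1 k kT.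
have mx i : measurable_fun setT (fun o => x_ k o i 0).
  exact: measurable_trajectory.
have mQ : measurable_fun setT (fun o => qform (Q k) (x_ k o)).
  exact: measurable_qform.
have Q0 o : 0 <= qform (Q k) (x_ k o) by apply: posdefmx_ge0; exact: Qpos.
apply: (@le_lt_trans _ _ (l1%:E * 'E_P[fun o => qform (Q k) (x_ k o)])%E).
  rewrite expectation.unlock -ge0_integralZl //; last 3 first.
  - exact/measurable_EFinP.
  - by move=> o _; rewrite lee_fin.
  - by rewrite lee_fin ltW.
  apply: ge0_le_integral => //.
  - by move=> o _; rewrite lee_fin; apply: posdefmx_ge0; exact: Wpos.
  - exact/measurable_EFinP/measurable_qform.
  - by apply: measurable_funeM; exact/measurable_EFinP.
  - by move=> o _; rewrite -EFinM lee_fin; exact: WQ.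
apply: (@le_lt_trans _ _ (l1 * qform (Q 0) x0)%:E).
  rewrite EFinM lee_pmul2l ?lte_fin //; exact: expectation_qform_decrease.
rewrite lte_fin -(ltr_pM2r l20); apply: le_lt_trans c12.
rewrite -mulrA mulrC ler_pM2r // mulrC; exact: le_trans Wc1.
Qed.

End Closed_loop.

Theorem mainTheorem8 (R : realType) (d : measure_display)
  (Omega : measurableType d) (P : probability Omega R)
  (hP : measure_is_complete P)
  (T : nat) (hT : (1 <= T)%N)
  (w : nat -> {RV P >-> R})
  (hw_indep : independent_RVs T w)
  (hw_mean : forall k : nat, (k < T)%N -> ('E_P[w k] = 0)%E)
  (hw_cov : forall k j : nat, (k < T)%N -> (j < T)%N ->
    ('E_P[fun omega => (w k omega * w j omega)%R] = ((k == j)%:R)%:E)%E)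
  (n m : nat) (c1 c2 : R) (hc1 : 0 < c1) (hc12 : c1 <= c2)
  (W : nat -> 'M[R]_n) (hW : forall i : nat, (i <= T)%N -> posdefmx (W i))
  (A C : nat -> 'M[R]_n) (B D : nat -> 'M[R]_(n, m))
  (X : nat -> 'M[R]_n) (Y : nat -> 'M[R]_(m, n)) (l1 l2 : R)
  (hX : forall i : nat, (i <= T)%N -> X i \is symmetricmx)
  (hl1 : 0 < l1) (hl2 : 0 < l2) (hl12 : l2 <= l1)
  (hXW : forall i : nat, (i <= T)%N ->
    loewner_le (l2 *: invmx (W i)) (X i) /\
    loewner_le (X i) (l1 *: invmx (W i)))
  (hc : c1 * l1 - c2 * l2 < 0)
  (hlmi : forall j : nat, (j < T)%N ->
    negdefmx (lmi_block (X j) (X j.+1)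
      (A j *m X j + B j *m Y j) (C j *m X j + D j *m Y j))) :
  finite_time_stabilizable w A C B D c1 c2 T W /\
  closed_loop_stable w A C B D (fun j => Y j *m invmx (X j)) c1 c2 T W.
Proof.
suff stable : closed_loop_stable w A C B D
    (fun j => Y j *m invmx (X j)) c1 c2 T W.
  by split=> //; exists (fun j => Y j *m invmx (X j)).
have sandwich i (iT : (i <= T)%N) :=
  invmx_sandwich hl1 hl2 (hW i iT) (hX i iT) (hXW i iT).1 (hXW i iT).2.
have Xpos i (iT : (i <= T)%N) : posdefmx (X i) by have [] := sandwich i iT.
move=> x0 x0c1; apply: (@expectation_qform_lt _ _ _ _ w T n hw_indep hw_mean _
  _ _ x0 (fun k => invmx (X k)) W c1 c2 l1 l2) => //.
- by move=> k kT; rewrite hw_cov // eqxx.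
- by rewrite -subr_lt0.
- by move=> k kT; exact/posdefmx_inv/Xpos.
- move=> k y kT.
  have := lmi_block_decrease y (Xpos k (ltnW kT)) (Xpos k.+1 kT) (hlmi k kT).
  have Xu := posdefmx_unit (Xpos k (ltnW kT)).
  (* (A X + B Y) X^-1 = A + B K *)
  by rewrite !mulmxDl -!mulmxA !(mulmxA (X k)) mulmxV // !mul1mx !mulmxA.
- by move=> k y kT; have [] := sandwich k kT.
- by have [] := sandwich 0%N (leq0n T).
Qed.
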